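(* Let $k\in\mathbb{N}$ and let $A\subset\mathbb{N}$ be a finite set of positions such that $|\varepsilon_c-\varepsilon_a|>(2/3)^k$ for all $a\ne c$ in $A$. Then $p_T(k)\ge |A|$. Equivalently, $p_T(k)\ge N\big((2/3)^k\big)$, where $N(\delta)$ denotes the largest cardinality of a $\delta$-separated subset of $\{\varepsilon_n : n\in\mathbb{N}\}$.
   Context: For $n\in\mathbb{N}=\{0,1,2,\dots\}$ let $m_n\in\mathbb{Z}$ be the nearest integer to $(3/2)^n$, with half-integers rounded up, and let $\varepsilon_n=(3/2)^n-m_n\in[-\tfrac12,\tfrac12)$. The steering letter is $t_n=2m_{n+1}-3m_n\in\{-2,-1,0,1,2\}$, and the steering word is the infinite word $T=(t_n)_{n\ge0}$. The subword complexity $p_T(k)$ is the number of distinct length-$k$ factors of $T$, i.e. the number of distinct blocks $(t_a,t_{a+1},\dots,t_{a+k-1})$ with $a\in\mathbb{N}$. A set of reals is $\delta$-separated if any two distinct elements $x,y$ of it satisfy $|x-y|>\delta$. *)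

(* Defs.v *)
From mathcomp Require Import all_boot all_order all_algebra finmap.
From mathcomp Require Import all_classical reals.

Set Implicit Arguments.
Unset Strict Implicit.
Unset Printing Implicit Defensive.

Import Order.TTheory GRing.Theory Num.Theory.

Local Open Scope classical_set_scope.
Local Open Scope card_scope.
Local Open Scope ring_scope.

(* Floor of x + 1/2: half-integers are rounded up. *)
Definition nearest_int (R : realType) (x : R) : int := Num.floor (x + 1 / 2).

Definition m (R : realType) (n : nat) : int := nearest_int ((3 / 2 : R) ^+ n).

Definition eps (R : realType) (n : nat) : R := (3 / 2) ^+ n - (m R n)%:~R.

Definition steering_word (R : realType) (n : nat) : int :=
  2 * m R n.+1 - 3 * m R n.

Definition factor (L : Type) (w : nat -> L) (k a : nat) : k.-tuple L :=
  [tuple w (a + i)%N | i < k].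

(* [fset_set] of an infinite set is empty, so this is the number of factors
   only when there are finitely many, as for a word over a finite alphabet. *)
Definition subword_complexity (L : choiceType) (w : nat -> L) (k : nat) : nat :=
  #|` fset_set (range (factor w k)) |%fset.

Definition separated (R : realType) (delta : R) (X : set R) : Prop :=
  forall x y, X x -> X y -> x <> y -> delta < `|x - y|.

(* N is the largest cardinality of a delta-separated subset of S. A relation
   rather than a function: no such N exists when these cardinalities are
   unbounded, and infinite subsets X are not excluded beforehand. *)
Definition is_max_separated_card (R : realType) (S : set R) (delta : R)
    (N : nat) : Prop :=
  (exists X : set R, [/\ X `<=` S, separated delta X & X #= `I_N]) /\
  (forall X : set R, X `<=` S -> separated delta X -> X #<= `I_N).

(* Main.v *)
(* Since eps_{n+1} = (3/2) eps_n - t_n / 2, two positions reading the same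
   length-k factor satisfy
   eps_{a+k} - eps_{c+k} = (3/2)^k (eps_a - eps_c).
   The left side has absolute value < 1, so |eps_a - eps_c| < (2/3)^k: positions
   whose errors are (2/3)^k-separated read distinct factors. *)
Require Import Defs.
From mathcomp Require Import all_boot all_order all_algebra finmap.
From mathcomp Require Import all_classical reals.
From mathcomp Require Import ring lra zify.

Import Order.TTheory GRing.Theory Num.Theory.

Local Open Scope classical_set_scope.
Local Open Scope ring_scope.

Lemma eps_itv (R : realType) (n : nat) : - (1 / 2) <= eps R n < 1 / 2.
Proof.
rewrite /eps /m /nearest_int.
set x := (3 / 2 : R) ^+ n.
have := floor_itv (x + 1 / 2); rewrite intrD => /andP[hle hlt].
by apply/andP; split; lra.
Qed.

(** The powers cancel, since [2 * (3 / 2) ^+ n.+1 = 3 * (3 / 2) ^+ n], so only the errors remain. *)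
Lemma steering_wordE (R : realType) (n : nat) :
  (steering_word R n)%:~R = 3 * eps R n - 2 * eps R n.+1.
Proof. by rewrite /steering_word /eps rmorphB !rmorphM /= exprS; field. Qed.

Lemma factorP (L : Type) (w : nat -> L) (k a c : nat) :
  Defs.factor w k a = Defs.factor w k c <->
  forall i, (i < k)%N -> w (a + i)%N = w (c + i)%N.
Proof.
split=> [e i ik|e]; last by apply: eq_from_tnth => i; rewrite !tnth_mktuple e.
by have := congr1 (fun s => tnth s (Ordinal ik)) e; rewrite !tnth_mktuple.
Qed.

Lemma eps_subD (R : realType) (k a c : nat) :
  Defs.factor (steering_word R) k a = Defs.factor (steering_word R) k c ->
  eps R (a + k) - eps R (c + k) = (3 / 2) ^+ k * (eps R a - eps R c).
Proof.
elim: k => [|k IHk] e; first by rewrite !addn0 expr0 mul1r.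
have {}IHk : eps R (a + k) - eps R (c + k) = (3 / 2) ^+ k * (eps R a - eps R c).
  by apply: IHk; apply/factorP => i ik; move/factorP: e; apply; exact: ltnW.
(* The last letters, at index [k], agree as well. Subtracting the two recurrences cancels them and
   multiplies the difference of errors by 3/2. *)
have /(congr1 (fun z : int => z%:~R : R)) :=
  proj1 (factorP _ _ _ _ _) e k (ltnSn k).
rewrite !steering_wordE !addnS exprS -mulrA -IHk => ht.
lra.
Qed.

Lemma eps_dist_lt (R : realType) (k a c : nat) :
  Defs.factor (steering_word R) k a = Defs.factor (steering_word R) k c ->
  `|eps R a - eps R c| < (2 / 3) ^+ k.
Proof.
move=> /eps_subD e.
have k_gt0 : 0 < (3 / 2 : R) ^+ k by apply: exprn_gt0; lra.
have -> : (2 / 3 : R) = (3 / 2)^-1 by rewrite invf_div.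
rewrite exprVn -[_^-1]mulr1 ltr_pdivlMl// -(gtr0_norm k_gt0) -normrM -e ltr_norml.
(* Both errors lie in the same half-open interval of length 1, so their distance is strictly below
   1. *)
have /andP[? ?] := eps_itv R (a + k); have /andP[? ?] := eps_itv R (c + k).
by apply/andP; split; lra.
Qed.

(** A factor of length [k.+1] is a letter followed by the factor of length [k] read one position
    later, so induction on [k] applies. *)
Lemma finite_range_factor (L : Type) (w : nat -> L) (k : nat) :
  finite_set (range w) -> finite_set (range (Defs.factor w k)).
Proof.
move=> wfin; elim: k => [|k IHk].
  apply: (sub_finite_set _ (finite_set1 [tuple])) => _ [a _ <-] /=.
  exact: tuple0.
apply: (sub_finite_set _
  (finite_image2 (fun x (s : k.-tuple L) => [tuple of x :: s]) wfin IHk)).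
move=> _ [a _ <-]; exists (w a); first by exists a.
exists (Defs.factor w k a.+1); first by exists a.+1.
apply: eq_from_tnth => i; rewrite tnth_mktuple.
case: (unliftP ord0 i) => [j|] ->; last by rewrite tnth0 addn0.
by rewrite tnthS tnth_mktuple /= addSnnS.
Qed.

Lemma finite_range_steering_word (R : realType) :
  finite_set (range (steering_word R)).
Proof.
apply: (sub_finite_set _
  (finite_image (fun i : nat => i%:Z - 2) (finite_II 5))).
move=> _ [n _ <-].
have /andP[? ?] := eps_itv R n; have /andP[? ?] := eps_itv R n.+1.
have ht := steering_wordE R n.
(* The bounds on the errors put [3 * eps R n - 2 * eps R n.+1] strictly between -5/2 and 5/2. The
   integer letter is thus one of -2, ..., 2, indexed by [I_5] after a shift by 2. *)
have lo : -3 < steering_word R n by rewrite -(ltr_int R) ht; lra.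
have hi : steering_word R n < 3 by rewrite -(ltr_int R) ht; lra.
by exists (absz (steering_word R n + 2)) => /=; lia.
Qed.

(** Finiteness of the set of factors rules out the default value of [fset_set], so the complexity is
    a true count. *)
Lemma range_factor_card (R : realType) (k : nat) :
  (range (Defs.factor (steering_word R) k) #=
   `I_(subword_complexity (steering_word R) k))%card.
Proof.
have /finite_setP[n en] :=
  finite_range_factor _ _ k (finite_range_steering_word R).
by rewrite /subword_complexity (card_fset_set en).
Qed.

(** Separation makes reading a factor injective on [A]. Finiteness of [A] is not assumed, so that
    both halves of the theorem can use the bound. *)
Lemma card_le_subword_complexity (R : realType) (k : nat) (A : set nat) :
  (forall a c, A a -> A c -> a <> c -> (2 / 3) ^+ k < `|eps R c - eps R a|) ->
  (A #<= `I_(subword_complexity (steering_word R) k))%card.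
Proof.
move=> sepA.
have inj : {in A &, injective (Defs.factor (steering_word R) k)}.
  move=> a c /set_mem Aa /set_mem Ac e; apply/eqP/negPn/negP => /eqP ac.
  by have := lt_trans (sepA a c Aa Ac ac) (eps_dist_lt _ _ _ _ (esym e));
    rewrite ltxx.
rewrite -(card_le_eqr (range_factor_card R k)) -(card_le_eql (inj_card_eq inj)).
by apply: subset_card_le => _ [a _ <-]; exists a.
Qed.

Lemma separated_card_le (R : realType) (k : nat) (X : set R) :
  X `<=` range (@eps R) -> separated ((2 / 3) ^+ k) X ->
  (X #<= `I_(subword_complexity (steering_word R) k))%card.
Proof.
(* [pos] picks one position for each error value; the default 0 is never taken on [X], which
   consists of such values. *)
move=> Xeps sepX; pose pos x := xget 0%N [set a | eps R a = x].
have posK x : X x -> eps R (pos x) = x.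
  by move=> /Xeps[a _ ax]; apply: (@xgetPex _ _ [set a | eps R a = x]); exists a.
have pos_inj : {in X &, injective pos}.
  by move=> x y /set_mem Xx /set_mem Xy e; rewrite -(posK x)// e posK.
rewrite -(card_le_eql (inj_card_eq pos_inj)).
apply: card_le_subword_complexity => _ _ [x Xx <-] [y Xy <-] xy.
by rewrite !posK//; apply: sepX => // yx; apply: xy; rewrite yx.
Qed.

(** The finite cardinalities attained by separated subsets include 0, from the empty set, and are
    bounded by [p], so they have a maximum. *)
Lemma exists_max_separated_card (R : realType) (S : set R) (delta : R)
    (p : nat) :
  (forall X, X `<=` S -> separated delta X -> (X #<= `I_p)%card) ->
  exists N, is_max_separated_card S delta N /\ (N <= p)%N.
Proof.
move=> Sp.
pose P n := `[< exists X, [/\ X `<=` S, separated delta X & (X #= `I_n)%card] >].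
have exP : exists n, P n.
  by exists 0%N; apply/asboolP; exists set0; split=> //; rewrite II0.
have leP n : P n -> (n <= p)%N.
  move=> /asboolP[X [XS sepX Xn]].
  by rewrite -card_le_II -(card_le_eql Xn); exact: Sp.
have [N /asboolP PN maxN] := ex_maxnP exP leP.
exists N; split; last by apply: leP; apply/asboolP.
split=> // X XS sepX.
(* The bound [p] forces [X] to be finite, so its cardinality is among those that [N] maximizes. *)
have /finite_setP[n Xn] := card_le_finite (Sp X XS sepX) (finite_II p).
by rewrite (card_le_eql Xn) card_le_II; apply: maxN; apply/asboolP; exists X.
Qed.

Theorem proposition1p2 (R : realType) (k : nat) :
  (forall A : {fset nat},
     (forall a c : nat, a \in A -> c \in A -> a <> c ->
        (2 / 3) ^+ k < `|eps R c - eps R a|) ->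
     (#|` A | <= subword_complexity (steering_word R) k)%N) /\
  (exists N : nat,
     is_max_separated_card (range (@eps R)) ((2 / 3) ^+ k) N /\
     (N <= subword_complexity (steering_word R) k)%N).
Proof.
split=> [A sepA|]; last first.
  by apply: exists_max_separated_card => X; exact: separated_card_le.
rewrite -[A in #|` A|]set_fsetK; apply: geq_card_fset_set.
exact: card_le_subword_complexity.
Qed.
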